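(* Let $\Gamma=C_2^{*3}\times C_3=\langle a_1,a_2,a_3,b : a_i^2=[a_i,b]=b^3=1\ (i=1,2,3)\rangle$ with generating set $E=\{a_1,a_2,a_3,b\}$, and let $G=\mathrm{Cay}(\Gamma,E)$. Then $G$ does not admit an approximate $\mathrm{Aut}(G)$-fiid $\Gamma$-Cayley diagram.
   Context: Let $S=E\cup E^{-1}$. $G$ is the graph with vertex set $\Gamma$ and edge set $\mathcal E=\{(x,\gamma x):x\in\Gamma,\gamma\in S\}$ (edges are ordered pairs). $\mathrm{Aut}(G)$ acts on $[0,1]^\Gamma$ and on edge labellings by $f\cdot x=x\circ f^{-1}$. An $\mathrm{Aut}(G)$-fiid edge labelling is a measurable map $\mathbf f$ from $([0,1]^\Gamma,\lambda^\Gamma)$ ($\lambda$ Lebesgue measure) to edge labellings that is $\mathrm{Aut}(G)$-equivariant almost everywhere, viewed as a random labelling. The standard Cayley diagram is $c_{st}(\gamma x,x)=\gamma$ ($x\in\Gamma,\gamma\in S$). An approximate $\mathrm{Aut}(G)$-fiid $\Gamma$-Cayley diagram is a sequence $(\mathbf f_i)_{i\in\mathbb N}$ of $\mathrm{Aut}(G)$-fiid edge labellings $\mathcal E\to S$ such that for every $r\in\mathbb N$, $\mathbb P\big((B_r(e),e,\mathbf f_i\restriction B_r(e))\cong(B_r(e),e,c_{st}\restriction B_r(e))\big)\to1$, where $\cong$ is isomorphism of rooted edge-labelled graphs. *)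

(* Defs.v *)
From HB Require Import structures.
From mathcomp Require Import all_boot all_order all_algebra.
From mathcomp Require Import all_classical all_reals all_analysis.

Set Implicit Arguments.
Unset Strict Implicit.
Unset Printing Implicit Defensive.

Import Order.TTheory GRing.Theory Num.Theory.
Import numFieldNormedType.Exports.

Local Open Scope classical_set_scope.
Local Open Scope ring_scope.

(* The free product of copies of C_2 indexed by I: words in I without two equal
   adjacent letters, multiplied by concatenation followed by cancellation. *)
Section FreeProductC2.
Variable I : choiceType.
Implicit Types (i : I) (u v w : seq I).

Definition reduced w := sorted (fun i j : I => i != j) w.

Definition freeC2 := {w : seq I | reduced w}.

HB.instance Definition _ := Choice.on freeC2.

Definition push i w :=
  if w is j :: w' then if i == j then w' else i :: w else [:: i].

Definition word_mul u v := foldr push v u.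

Lemma reduced_push i w : reduced w -> reduced (push i w).
Proof.
case: w => [|j w] //= rw; case: eqP => [_|/eqP ij]; first exact: path_sorted rw.
by rewrite /= ij.
Qed.

Lemma pushK i w : reduced w -> push i (push i w) = w.
Proof.
case: w => [|j w] /=; first by rewrite eqxx.
case: eqP => [->|ij]; last by rewrite /= eqxx.
by case: w => [|k w] //= /andP[/negPf->].
Qed.

Lemma reduced_mul u v : reduced v -> reduced (word_mul u v).
Proof. by move=> rv; elim: u => //= i u; exact: reduced_push. Qed.

Lemma word_mul_push i v w :
  reduced w -> word_mul (push i v) w = push i (word_mul v w).
Proof.
move=> rw; case: v => [|j v] //=; case: eqP => [->|//].
by rewrite pushK// reduced_mul.
Qed.

Lemma word_mulA u v w :
  reduced w -> word_mul u (word_mul v w) = word_mul (word_mul u v) w.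
Proof. by move=> rw; elim: u => //= i u ->; rewrite word_mul_push. Qed.

Lemma word_mulw1 u : reduced u -> word_mul u [::] = u.
Proof.
elim: u => //= i u IHu ru; rewrite IHu; last exact: path_sorted ru.
by case: u ru {IHu} => //= j u /andP[/negPf->].
Qed.

Lemma reduced_rev u : reduced u -> reduced (rev u).
Proof.
move=> ru; rewrite /reduced rev_sorted; apply: sub_sorted ru => i j.
by rewrite eq_sym.
Qed.

Lemma word_mulVw u : word_mul (rev u) u = [::].
Proof.
rewrite -[u in X in word_mul _ X]cats0; elim: u [::] => //= i u IHu w.
by rewrite rev_cons /word_mul foldr_rcons /= eqxx; exact: IHu.
Qed.

Definition freeC2_one : freeC2 := exist _ [::] isT.
Definition freeC2_mul (x y : freeC2) : freeC2 :=
  exist _ (word_mul (val x) (val y)) (reduced_mul (val x) (valP y)).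
Definition freeC2_inv (x : freeC2) : freeC2 :=
  exist _ (rev (val x)) (reduced_rev (valP x)).

Fact freeC2_mulA : associative freeC2_mul.
Proof. by move=> x y z; apply: val_inj => /=; exact: word_mulA (valP z). Qed.

Fact freeC2_mul1g : left_id freeC2_one freeC2_mul.
Proof. by move=> x; exact: val_inj. Qed.

Fact freeC2_mulg1 : right_id freeC2_one freeC2_mul.
Proof. by move=> x; apply: val_inj => /=; exact: word_mulw1 (valP x). Qed.

Fact freeC2_mulVg : left_inverse freeC2_one freeC2_inv freeC2_mul.
Proof. by move=> x; apply: val_inj; exact: word_mulVw. Qed.

Fact freeC2_mulgV : right_inverse freeC2_one freeC2_inv freeC2_mul.
Proof.
move=> x; apply: val_inj => /=.
by rewrite -[X in word_mul X _]revK word_mulVw.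
Qed.

HB.instance Definition _ := isGroup.Build freeC2 freeC2_mulA freeC2_mul1g
  freeC2_mulg1 freeC2_mulVg freeC2_mulgV.

Definition freeC2_gen i : freeC2 := exist _ [:: i] isT.

End FreeProductC2.

(* 'I_3 carries its cyclic group structure (addition modulo 3). *)
Definition Gam : groupType := (freeC2 'I_3 * 'I_3)%type.

Definition gen_a (i : 'I_3) : Gam := (freeC2_gen i, 1%g).
Definition gen_b : Gam := (1%g, inZp 1).

Definition gens : seq Gam := [:: gen_a 0; gen_a 1; gen_a 2; gen_b].

Section Presentation.
Local Open Scope group_scope.

Lemma gen_a2 i : gen_a i ^+ 2 = 1.
Proof.
rewrite expg2; congr (_, _); last by rewrite mulg1.
by apply: val_inj; rewrite /= eqxx.
Qed.

Lemma gen_ab i : [~ gen_a i, gen_b] = 1.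
Proof.
rewrite commgEl; congr (_, _).
  by rewrite /conjg /= mulg1 invg1 mul1g mulVg.
by rewrite /conjg /= invg1 !mul1g mulVg.
Qed.

Lemma gen_b3 : gen_b ^+ 3 = 1.
Proof.
rewrite !expgS expg0; congr (_, _); first by rewrite /= !mulg1.
exact: val_inj.
Qed.

(* Gam is the group presented by the relations gen_a2, gen_ab and gen_b3. *)
Lemma Gam_presentation (H : groupType) (s : 'I_3 -> H) (t : H) :
    (forall i, s i ^+ 2 = 1) -> (forall i, [~ s i, t] = 1) -> t ^+ 3 = 1 ->
  exists! f : Gam -> H, [/\ {morph f : x y / x * y},
    forall i, f (gen_a i) = s i & f gen_b = t].
Proof.
move=> s2 st t3.
pose ev := foldr (fun i h => s i * h) 1.
have ev_push i w : ev (push i w) = s i * ev w.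
  case: w => [|j w] //=; case: eqP => [->|//].
  by rewrite mulgA -expg2 s2 mul1g.
have ev_mul u v : ev (word_mul u v) = ev u * ev v.
  by elim: u => [|i u IHu] /=; rewrite ?mul1g// ev_push IHu mulgA.
have evt u n : commute (ev u) (t ^+ n).
  apply: commuteX; elim: u => [|i u IHu] /=; first exact/commute_sym/commute1.
  apply/commute_sym/commuteM; apply/commute_sym => //.
  exact/commgP/eqP/st.
have tmod k : t ^+ (k %% 3) = t ^+ k.
  by rewrite [in RHS](divn_eq k 3) expgnDr mulnC expgnA t3 expg1n mul1g.
pose f (x : Gam) := ev (val x.1) * t ^+ (val x.2).
exists f; split; first split.
- move=> [x m] [y n]; rewrite /f /= ev_mul tmod expgnDr.
  by rewrite -!mulgA; congr (_ * _); rewrite !mulgA evt.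
- by move=> i; rewrite /f /= !mulg1.
- by rewrite /f /= mul1g.
move=> g [gM gs gt]; apply/funext => -[[w rw] n].
have g1 : g 1 = 1 by apply: (mulgI (g 1)); rewrite -gM !mulg1.
have gX k : g (gen_b ^+ k) = t ^+ k.
  by elim: k => // k IHk; rewrite !expgS gM gt IHk.
have bX k : gen_b ^+ k = (1, inZp k) :> Gam.
  elim: k => [|k IHk]; first by congr (_, _); apply: val_inj.
  rewrite expgS IHk; congr (_, _); first by rewrite /= mulg1.
  by apply: val_inj; rewrite /= modnDml modnDmr.
have -> : (exist _ w rw, n) = ((exist _ w rw, 1) : Gam) * gen_b ^+ (val n).
  rewrite bX; congr (_, _); first by rewrite /= mulg1.
  by rewrite /= mul1g valZpK.
rewrite gM gX /f bX /= word_mulw1//; congr (_ * _); last first.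
  by rewrite add0n !modn_mod modn_small.
elim: w rw => [|i w IHw] rw.
  by transitivity (g 1) => //; congr (g (_, _)); apply: val_inj.
have rw' : reduced w by exact: path_sorted rw.
transitivity (s i * ev w) => //.
rewrite (IHw rw') -gs -gM; congr (g (_, _)); last by rewrite /= mul1g.
by apply: val_inj => /=; case: w rw {IHw rw'} => //= j w /andP[/negPf->].
Qed.

End Presentation.

Section CayleyGraph.
Variables (G : groupType) (E : seq G).
Local Open Scope group_scope.

Definition conn_set : pred G := fun g => (g \in E) || (g^-1 \in E).

(* adj x y says that (x, y) = (x, g * x) for some g in conn_set. *)
Definition adj : rel G := fun x y => conn_set (y * x^-1).

Definition edge := {p : G * G | adj p.1 p.2}.
Definition label := {g : G | conn_set g}.
Definition labelling := edge -> label.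

Fact conn_setV g : conn_set g -> conn_set g^-1.
Proof. by rewrite /conn_set orbC invgK. Qed.

Fact std_label_subproof (p : edge) : conn_set ((val p).1 * (val p).2^-1).
Proof. by have := conn_setV (valP p); rewrite invgM invgK. Qed.

(* The edge (g * x, x) has label g. *)
Definition std_diagram : labelling :=
  fun p => exist _ ((val p).1 * (val p).2^-1) (std_label_subproof p).

Record graph_aut := GraphAut {
  aut_fun :> G -> G;
  aut_inv : G -> G;
  aut_funK : cancel aut_fun aut_inv;
  aut_invK : cancel aut_inv aut_fun;
  aut_adj : forall x y, adj (aut_fun x) (aut_fun y) = adj x y }.

Fact inv_edge_subproof (f : graph_aut) (p : edge) :
  adj (aut_inv f (val p).1) (aut_inv f (val p).2).
Proof. by rewrite -(aut_adj f) !aut_invK; exact: valP p. Qed.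

Definition inv_edge (f : graph_aut) (p : edge) : edge :=
  exist _ (aut_inv f (val p).1, aut_inv f (val p).2) (inv_edge_subproof f p).

Definition act_labelling (f : graph_aut) (c : labelling) : labelling :=
  c \o inv_edge f.

Definition gball (r : nat) : set G :=
  [set x | exists p : seq G, [/\ path adj 1 p, last 1 p = x & (size p <= r)%N]].

(* Isomorphism of rooted edge-labelled graphs between the subgraphs induced on
   the r-ball around 1, labelled by (the restrictions of) c and c'. *)
Definition rooted_ball_iso (r : nat) (c c' : labelling) : Prop :=
  exists phi : G -> G,
    [/\ set_bij (gball r) (gball r) phi,
        phi 1 = 1,
        forall x y, gball r x -> gball r y -> adj (phi x) (phi y) = adj x y &
        forall p q : edge, gball r (val p).1 -> gball r (val p).2 ->
          val q = (phi (val p).1, phi (val p).2) -> c p = c' q].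

End CayleyGraph.

Section Fiid.
Variables (R : realType) (G : groupType) (E : seq G).

Definition unit_itv := {t : R | 0 <= t <= 1}.

Fact unit_itv0_subproof : (0 : R) <= 0 <= (1 : R).
Proof. by rewrite lexx ler01. Qed.

HB.instance Definition _ := Choice.on unit_itv.
HB.instance Definition _ :=
  isPointed.Build unit_itv (exist _ 0 unit_itv0_subproof).

Definition coord_cylinders : set (set (G -> unit_itv)) :=
  [set A | exists g (B : set R), measurable B /\ A = [set x | B (val (x g))]].

(* [0, 1]^G with the product sigma-algebra. *)
Definition seeds := g_sigma_algebraType coord_cylinders.

Definition act_seeds (f : graph_aut E) (x : seeds) : seeds := x \o aut_inv f.

(* mu is the product over G of the Lebesgue measure on [0, 1]: this determines
   mu, since finite-dimensional cylinders form a generating pi-system. *)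
Definition lebesgue_product (mu : probability seeds R) : Prop :=
  forall (s : seq G) (B : G -> set R),
    uniq s -> (forall g, measurable (B g)) ->
    mu [set x : seeds | forall g, g \in s -> B g (val (x g))] =
    (\prod_(g <- s) lebesgue_measure (B g `&` `[0%R, 1%R]))%E.

Definition label_cylinders : set (set (labelling E)) :=
  [set A | exists p s, A = [set c : labelling E | c p = s]].

(* Labellings carry the product of the discrete sigma-algebras. *)
Definition measurable_labelling (F : seeds -> labelling E) : Prop :=
  forall C, <<s label_cylinders >> C -> measurable (F @^-1` C).

Definition fiid_labelling (mu : probability seeds R)
    (F : seeds -> labelling E) : Prop :=
  measurable_labelling F /\
  forall f : graph_aut E,
    {ae mu, forall x, F (act_seeds f x) = act_labelling f (F x)}.

Definition approx_fiid_cayley_diagram (mu : probability seeds R)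
    (F : nat -> seeds -> labelling E) : Prop :=
  (forall i, fiid_labelling mu (F i)) /\
  forall r : nat,
    mu [set x | rooted_ball_iso r (F i x) (@std_diagram G E)]
      @[i --> \oo] --> 1%:E.

End Fiid.

(* Main.v *)
Require Import Defs.
From mathcomp Require Import all_boot all_order all_algebra.
From mathcomp Require Import all_classical all_reals all_analysis.
From mathcomp Require Import measurable_realfun ring lra.

Set Implicit Arguments.
Unset Strict Implicit.
Unset Printing Implicit Defensive.

Import Order.TTheory GRing.Theory Num.Theory.
Import numFieldNormedType.Exports.

Local Open Scope classical_set_scope.
Local Open Scope ring_scope.

(** A Cayley diagram orients every triangle {g, b g, b^2 g} of G through its
    b-labelled edges, and since b commutes with each a_i, neighbouring
    triangles receive the same orientation.  The orientation is thus one
    global bit.  An approximate fiid diagram would let the triangles agree on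
    this bit, with high probability at each place, by a rule that cannot
    distinguish its two values: the reflection k |-> k^-1 of the C_3 factor is
    an automorphism of G that exchanges them.  Let A be the event that the
    edge (b, 1) is labelled b.  On the event that the labelled 2-ball is
    isomorphic to the standard one, the bit is invariant under every a_i and
    flipped by the reflection ([ball_iso_labels]), so A is nearly invariant
    under the a_i ([orientation_invariant]) while its probability is nearly
    1/2 ([orientation_balanced]).

    No such event exists because C_2 * C_2 * C_2 is non-amenable: its
    Bernoulli action has a spectral gap, which here takes the form
      P(A) (1 - P(A)) <= 6 \sum_i P(A \ a_i^-1 A)
    for every measurable A ([bernoulli_expansion]).  It is enough to prove
    this for events depending on finitely many seeds, as these approximate
    all events ([measurable_finite_range_approx]).  Let B be such an event,
    f = 1_B - P(B), and M the average over the three a_i, acting on functions.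
    The translates of f by long reduced words are orthogonal to f, by
    independence, and a word of n random letters in C_2 * C_2 * C_2 is
    short only with exponentially small probability, so
    <f, M^n f> <= C (17/18)^n ([walk_correlation_decay]).  As M is
    self-adjoint, Cauchy-Schwarz makes <f, M^(2^k) f> at least
    <f, f> (<f, M f> / <f, f>)^(2^k); hence
    <f, M f> <= (17/18) <f, f> ([spectral_ratio], [avg_spectral_gap]), and
    expanding the indicator functions gives the inequality.

    The probability of the ball event can be compared with that of A because
    the event is measurable: it depends on the labels of finitely many edges,
    each with finitely many possible values ([measurable_ball_event]). *)

(** * Bounded functions on a probability space *)

(** If q n = <f, M^n f> with M self-adjoint, Cauchy-Schwarz gives the third
    hypothesis.  Were q 1 / q 0 larger than rho, repeated squaring would make
    q (2^n) at least q 0 (q 1 / q 0)^(2^n), against the geometric bound. *)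
Lemma spectral_ratio (R : realType) (q : nat -> R) (rho C : R) :
    0 < rho -> 0 <= q 0%N ->
    (forall n, q n ^+ 2 <= q 0%N * q (n + n)%N) ->
    (forall n, q n <= C * rho ^+ n) ->
  q 1%N <= rho * q 0%N.
Proof.
move=> rho0 q0_ge0 CS qC; rewrite leNgt; apply/negP => q1.
have q1_gt0 : 0 < q 1%N by apply: le_lt_trans q1; rewrite mulr_ge0// ltW.
have q0_gt0 : 0 < q 0%N.
  rewrite lt_neqAle q0_ge0 andbT; apply/eqP => q00.
  by have := CS 1%N; rewrite -q00 mul0r leNgt exprn_gt0.
pose t := q 1%N / (rho * q 0%N).
have t1 : 1 < t by rewrite /t ltr_pdivlMr ?mul1r// mulr_gt0.
have dbl n : q 0%N * (rho * t) ^+ (2 ^ n) <= q (2 ^ n)%N.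
  have kE : q 0%N * (rho * t) = q 1%N by rewrite /t; field; rewrite !gt_eqF.
  have k0 : 0 <= rho * t by rewrite ltW// mulr_gt0// (lt_trans _ t1).
  elim: n => [|n IHn]; first by rewrite expn0 expr1 kE.
  rewrite expnS mul2n -addnn exprD -(ler_pM2l q0_gt0).
  apply: le_trans (CS _).
  rewrite [leLHS](_ : _ = (q 0%N * (rho * t) ^+ (2 ^ n)) ^+ 2); last by ring.
  rewrite !expr2; apply: ler_pM => //; by rewrite mulr_ge0// exprn_ge0.
have bern k : 1 + k%:R * (t - 1) <= t ^+ k.
  elim: k => [|k IHk]; first by rewrite mul0r addr0 expr0.
  rewrite exprS -natr1; apply: (@le_trans _ _ (t * (1 + k%:R * (t - 1)))).
    have : 0 <= k%:R * (t - 1) ^+ 2 by rewrite mulr_ge0// sqr_ge0.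
    lra.
  by rewrite ler_pM2l// (lt_trans _ t1).
pose n := Num.bound `|C / q 0%N / (t - 1)|.
have tn : C / q 0%N < n%:R * (t - 1).
  rewrite -ltr_pdivrMr ?subr_gt0//.
  exact: le_lt_trans (ler_norm _) (archi_boundP (normr_ge0 _)).
have : C < q 0%N * t ^+ (2 ^ n).
  rewrite mulrC -ltr_pdivrMr//; apply: lt_le_trans tn _.
  apply: le_trans (bern _); apply: (@le_trans _ _ ((2 ^ n)%:R * (t - 1))).
    by rewrite ler_wpM2r ?subr_ge0 1?(ltW t1)// ler_nat ltnW// ltn_expl.
  by rewrite lerDr.
rewrite ltNge => /negP; apply.
have rn : 0 < rho ^+ (2 ^ n) by rewrite exprn_gt0.
rewrite -(ler_pM2r rn) -mulrA -exprMn [t * _]mulrC.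
exact: le_trans (dbl n) (qC _).
Qed.

Section BoundedMeasurable.
Context d (X : measurableType d) (R : realType) (mu : probability X R).
Implicit Types (f g : X -> R) (A B : set X).

Definition bounded_mfun f :=
  measurable_fun setT f /\ exists K : R, forall x, `|f x| <= K.

Lemma preimage_measurable (T : X -> X) A :
  measurable_fun setT T -> measurable A -> measurable (T @^-1` A).
Proof. by move=> mT mA; rewrite -[X in measurable X]setTI; exact: mT. Qed.

Definition prob A : R := fine (mu A).

Lemma probE A : measurable A -> mu A = (prob A)%:E.
Proof. by move=> mA; rewrite fineK// fin_num_measure. Qed.

Lemma prob_ge0 A : 0 <= prob A.
Proof. exact/fine_ge0/measure_ge0. Qed.

Lemma le_prob A B :
  measurable A -> measurable B -> A `<=` B -> prob A <= prob B.
Proof.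
move=> mA mB AB; rewrite -lee_fin -!probE//.
by apply: le_measure => //; rewrite inE.
Qed.

Lemma prob_setU A B : measurable A -> measurable B ->
  prob (A `|` B) <= prob A + prob B.
Proof.
move=> mA mB; rewrite -lee_fin EFinD -!probE//; last exact: measurableU.
exact: measureU2.
Qed.

Lemma probD A B : measurable A -> measurable B ->
  prob (A `\` B) = prob A - prob (A `&` B).
Proof.
move=> mA mB; apply: EFin_inj; rewrite EFinB -!probE//.
- by rewrite measureD// -ge0_fin_numE// fin_num_measure.
- exact: measurableI.
- exact: measurableD.
Qed.

Lemma probC A : measurable A -> prob (~` A) = 1 - prob A.
Proof.
move=> mA; apply: EFin_inj; rewrite EFinB -!probE//; last exact: measurableC.
exact: probability_setC.
Qed.

Definition inner f g : R := \int[mu]_x (f x * g x).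

Lemma bounded_mfun_cst c : bounded_mfun (fun=> c).
Proof. by split=> //; exists `|c|. Qed.

Lemma bounded_mfun_indic A : measurable A -> bounded_mfun \1_A.
Proof.
move=> mA; split; first exact: measurable_indic.
by exists 1 => x; rewrite indicE; case: (_ \in _); rewrite ?normr1 ?normr0.
Qed.

Lemma bounded_mfunD f g :
  bounded_mfun f -> bounded_mfun g -> bounded_mfun (fun x => f x + g x).
Proof.
move=> [mf [K fK]] [mg [L gL]]; split; first exact: measurable_funD.
by exists (K + L) => x; apply: le_trans (ler_normD _ _) (lerD _ _).
Qed.

Lemma bounded_mfunM f g :
  bounded_mfun f -> bounded_mfun g -> bounded_mfun (fun x => f x * g x).
Proof.
move=> [mf [K fK]] [mg [L gL]]; split; first exact: measurable_funM.
by exists (K * L) => x; rewrite normrM ler_pM.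
Qed.

Lemma bounded_mfunZ c f : bounded_mfun f -> bounded_mfun (fun x => c * f x).
Proof. exact: bounded_mfunM (bounded_mfun_cst c). Qed.

Lemma bounded_mfun_sum (I : Type) (r : seq I) (F : I -> X -> R) :
  (forall i, bounded_mfun (F i)) -> bounded_mfun (fun x => \sum_(i <- r) F i x).
Proof.
move=> bF; elim: r => [|i r IHr].
  by under eq_fun do rewrite big_nil; exact: bounded_mfun_cst.
by under eq_fun do rewrite big_cons; exact: bounded_mfunD.
Qed.

Lemma bounded_mfun_comp (T : X -> X) f :
  measurable_fun setT T -> bounded_mfun f -> bounded_mfun (f \o T).
Proof.
by move=> mT [mf [K fK]]; split; [exact: measurableT_comp|exists K => x /=].
Qed.

Lemma bounded_mfun_integrable f :
  bounded_mfun f -> mu.-integrable setT (EFin \o f).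
Proof.
have muT : (mu setT < +oo)%E by rewrite probability_setT ltry.
move=> [mf [K fK]]; apply: measurable_bounded_integrable => //.
exists K; split; first exact: num_real.
by move=> L KL x _ /=; exact: le_trans (fK x) (ltW KL).
Qed.

Lemma RintegralT_cst (c : R) : \int[mu]_x c = c.
Proof.
rewrite Rintegral_cst//; have /(congr1 fine)/= -> := @probability_setT _ _ _ mu.
by rewrite mulr1.
Qed.

Lemma RintegralT_sum (I : Type) (r : seq I) (F : I -> X -> R) :
    (forall i, bounded_mfun (F i)) ->
  \int[mu]_x (\sum_(i <- r) F i x) = \sum_(i <- r) \int[mu]_x F i x.
Proof.
move=> bF; elim: r => [|i r IHr].
  rewrite big_nil; under eq_Rintegral do rewrite big_nil.
  exact: RintegralT_cst.
rewrite big_cons -IHr; under eq_Rintegral do rewrite big_cons.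
by apply: RintegralD => //; apply: bounded_mfun_integrable => //;
  exact: bounded_mfun_sum.
Qed.

Lemma innerC f g : inner f g = inner g f.
Proof. by apply: eq_Rintegral => x _; rewrite mulrC. Qed.

Lemma inner_ge0 f : 0 <= inner f f.
Proof. by apply: Rintegral_ge0 => x _; rewrite -expr2 sqr_ge0. Qed.

Lemma innerDl f g h : bounded_mfun f -> bounded_mfun g -> bounded_mfun h ->
  inner (fun x => f x + g x) h = inner f h + inner g h.
Proof.
move=> bf bg bh; rewrite /inner -RintegralD//;
  try by apply: bounded_mfun_integrable; exact: bounded_mfunM.
by apply: eq_Rintegral => x _; rewrite mulrDl.
Qed.

Lemma innerZl c f h : bounded_mfun f -> bounded_mfun h ->
  inner (fun x => c * f x) h = c * inner f h.
Proof.
move=> bf bh; rewrite /inner -RintegralZl//; last first.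
  by apply: bounded_mfun_integrable; exact: bounded_mfunM.
by apply: eq_Rintegral => x _; rewrite mulrA.
Qed.

Lemma inner_suml (I : Type) (r : seq I) (F : I -> X -> R) h :
    (forall i, bounded_mfun (F i)) -> bounded_mfun h ->
  inner (fun x => \sum_(i <- r) F i x) h = \sum_(i <- r) inner (F i) h.
Proof.
move=> bF bh; rewrite /inner -RintegralT_sum; last first.
  by move=> i; exact: bounded_mfunM.
by apply: eq_Rintegral => x _; rewrite mulr_suml.
Qed.

(** With a = <f,f>, b = <f,g>, c = <g,g>, the inequality is the value at
    (c, -b) of the nonnegative quadratic form s, t |-> |s f + t g|^2 when
    c > 0; when c = 0 its value at (b, -(a+1)) forces b = 0. *)
Lemma inner_cauchy_schwarz f g : bounded_mfun f -> bounded_mfun g ->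
  inner f g ^+ 2 <= inner f f * inner g g.
Proof.
move=> bf bg.
set a := inner f f; set b := inner f g; set c := inner g g.
have quad s t : 0 <= s ^+ 2 * a + 2 * s * t * b + t ^+ 2 * c.
  have bsf := bounded_mfunZ s bf; have btg := bounded_mfunZ t bg.
  have := inner_ge0 (fun x => s * f x + t * g x).
  rewrite innerDl ?innerZl//; try exact: bounded_mfunD.
  rewrite ![inner _ (fun x => _ + _)]innerC !innerDl// !innerZl//.
  rewrite [inner g f]innerC -/a -/b -/c.
  congr (_ <= _); ring.
have c0 : 0 <= c by exact: inner_ge0.
have a0 : 0 <= a by exact: inner_ge0.
move: c0; rewrite le_eqVlt => /orP[/eqP c0|c0].
  have := quad b (- (a + 1)); rewrite -c0 mulr0 addr0 => q.
  rewrite mulr0; have b2 : 0 <= b ^+ 2 by exact: sqr_ge0.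
  have ab2 : 0 <= a * b ^+ 2 by exact: mulr_ge0.
  lra.
rewrite -subr_ge0 -(pmulr_rge0 _ c0).
by have := quad c (- b); congr (_ <= _); ring.
Qed.

Lemma inner_bound f g K : bounded_mfun f -> bounded_mfun g ->
  (forall x, `|f x| <= K) -> (forall x, `|g x| <= K) -> inner f g <= K ^+ 2.
Proof.
move=> bf bg fK gK; rewrite /inner.
apply: (@le_trans _ _ (\int[mu]_x (K ^+ 2))).
  apply: le_Rintegral => //.
  - exact: bounded_mfun_integrable (bounded_mfunM bf bg).
  - exact: bounded_mfun_integrable (bounded_mfun_cst _).
  move=> x _; apply: le_trans (ler_norm _) _.
  by rewrite normrM expr2 ler_pM.
by rewrite RintegralT_cst.
Qed.

Lemma inner_indic (A B : set X) (a b : R) : measurable A -> measurable B ->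
  inner (fun x => \1_A x - a) (fun x => \1_B x - b) =
  fine (mu (A `&` B)) - b * fine (mu A) - a * fine (mu B) + a * b.
Proof.
move=> mA mB; have mAB : measurable (A `&` B) by exact: measurableI.
have int1 D : measurable D -> \int[mu]_x \1_D x = fine (mu D).
  by move=> mD; rewrite /Rintegral integral_indic// setIT.
have bA := bounded_mfun_indic mA; have bB := bounded_mfun_indic mB.
have bAB := bounded_mfun_indic mAB.
have -> : inner (fun x => \1_A x - a) (fun x => \1_B x - b) =
    \int[mu]_x ((\1_(A `&` B) x + (- b) * \1_A x) + ((- a) * \1_B x + a * b)).
  apply: eq_Rintegral => x _; rewrite (_ : \1_(A `&` B) x = \1_A x * \1_B x).
    ring.
  by rewrite indicI.
have bZA := bounded_mfunZ (- b) bA; have bZB := bounded_mfunZ (- a) bB.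
have bc := bounded_mfun_cst (a * b).
rewrite !RintegralD ?RintegralZl//;
  try by apply: bounded_mfun_integrable => //;
    first [exact: bounded_mfunD | exact: bounded_mfun_cst].
by rewrite !int1// RintegralT_cst; ring.
Qed.

Definition measure_preserving (T : X -> X) :=
  measurable_fun setT T /\ forall A, measurable A -> mu (T @^-1` A) = mu A.

Lemma Rintegral_preserving T f : measure_preserving T -> bounded_mfun f ->
  \int[mu]_x f (T x) = \int[mu]_x f x.
Proof.
move=> [mT pT] bf; rewrite /Rintegral; congr fine.
have mf : measurable_fun setT (EFin \o f).
  by apply/measurable_EFinP; exact: bf.1.
have iT : mu.-integrable (T @^-1` setT) ((EFin \o f) \o T).
  exact: bounded_mfun_integrable (bounded_mfun_comp mT bf).
have := integral_pushforward mT mf iT measurableT.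
rewrite preimage_setT => <-.
by apply: eq_measure_integral => A mA _; exact: pT.
Qed.

Lemma inner_preserving T f g : measure_preserving T ->
    bounded_mfun f -> bounded_mfun g ->
  inner (f \o T) (g \o T) = inner f g.
Proof.
by move=> pT bf bg; exact: (Rintegral_preserving pT (bounded_mfunM bf bg)).
Qed.

End BoundedMeasurable.

(** * Spectral gap for three involutions with decaying correlations *)

Section TreeWalk.
Context d (X : measurableType d) (R : realType) (mu : probability X R).
Variable T : 'I_3 -> X -> X.
Hypothesis T_preserving : forall i, measure_preserving mu (T i).
Hypothesis TK : forall i, involutive (T i).

Definition avg (f : X -> R) (x : X) : R := 3^-1 * \sum_(i < 3) f (T i x).

Fixpoint walk (w : seq 'I_3) (x : X) : X :=
  if w is i :: w' then walk w' (T i x) else x.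

(** As the T i are involutions, they define an action of the free product of
    three copies of C_2, and [walk] is insensitive to cancellation. *)
Lemma walk_push i w x : walk (push i w) x = walk w (T i x).
Proof. by case: w => [|j w] //=; case: eqP => [->|//]; rewrite TK. Qed.

Lemma measurable_walk w : measurable_fun setT (walk w).
Proof.
elim: w => [|i w IHw]; first exact: measurable_id.
exact: measurableT_comp IHw (T_preserving i).1.
Qed.

Lemma bounded_mfun_avg f : bounded_mfun f -> bounded_mfun (avg f).
Proof.
move=> bf; apply/bounded_mfunZ/bounded_mfun_sum => i.
exact: bounded_mfun_comp (T_preserving i).1 bf.
Qed.

Lemma bounded_mfun_iter_avg n f :
  bounded_mfun f -> bounded_mfun (iter n avg f).
Proof. by move=> bf; elim: n => //= n; exact: bounded_mfun_avg. Qed.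

Lemma inner_avgl f g : bounded_mfun f -> bounded_mfun g ->
  inner mu (avg f) g = 3^-1 * \sum_(i < 3) inner mu (f \o T i) g.
Proof.
move=> bf bg.
have bfT i : bounded_mfun (f \o T i).
  exact: bounded_mfun_comp (T_preserving i).1 bf.
rewrite innerZl//; last exact: bounded_mfun_sum.
by rewrite inner_suml.
Qed.

(** Each T i is an involution preserving the measure, hence self-adjoint as an
    operator on functions. *)
Lemma avg_adjoint f g : bounded_mfun f -> bounded_mfun g ->
  inner mu (avg f) g = inner mu f (avg g).
Proof.
move=> bf bg; rewrite [RHS]innerC !inner_avgl//; congr (_ * _).
apply: eq_bigr => i _; rewrite [RHS]innerC.
have bfT := bounded_mfun_comp (T_preserving i).1 bf.
rewrite -(inner_preserving (T_preserving i) bfT bg).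
by congr inner; apply/funext => x /=; rewrite TK.
Qed.

Lemma iter_avg_adjoint n f g : bounded_mfun f -> bounded_mfun g ->
  inner mu (iter n avg f) g = inner mu f (iter n avg g).
Proof.
move=> bf bg; elim: n g bg => [//|n IHn] g bg.
rewrite iterS avg_adjoint//; last exact: bounded_mfun_iter_avg.
by rewrite IHn ?iterSr//; exact: bounded_mfun_avg.
Qed.

(** The tree estimate behind the gap: from a word of positive length, one
    letter out of three shortens it and two lengthen it, so pushing a random
    letter contracts the weight (2/3)^length on average, by
    (1/3) (3/2) + (2/3) (2/3) = 17/18; at the empty word the factor is 2/3.
    Any base strictly between 1/2 and 1 gives some contraction. *)
Lemma sum_weight_push (w : seq 'I_3) :
  \sum_(i < 3) (2 / 3 : R) ^+ size (push i w) <=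
  3 * (17 / 18) * (2 / 3) ^+ size w.
Proof.
case: w => [|j w]; first by rewrite !big_ord_recl big_ord0 /= expr1 expr0; lra.
rewrite (bigD1 j)//= eqxx.
rewrite (eq_bigr (fun=> (2 / 3 : R) ^+ (size w).+2)); last first.
  by move=> i /negPf ij; rewrite ij.
rewrite sumr_const cardC1 card_ord -mulr_natr !exprS.
have : 0 <= (2 / 3 : R) ^+ size w by rewrite exprn_ge0//; lra.
rewrite /=; lra.
Qed.

Section Decay.
Variables (f : X -> R) (m : nat) (K : R).
Hypothesis bf : bounded_mfun f.
Hypothesis fK : forall x, `|f x| <= K.
Hypothesis f_indep : forall w, reduced w -> (m < size w)%N ->
  inner mu (f \o walk w) f = 0.

(** Induction on n: self-adjointness moves one average onto the left factor,
    where it becomes a random letter pushed onto w, and [sum_weight_push]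
    gives the factor 17/18.  The prefactor (3/2)^m makes the case n = 0 hold
    for the words of length at most m, whose translates of f may correlate
    with f. *)
Lemma walk_correlation_decay n w : reduced w ->
  inner mu (f \o walk w) (iter n avg f) <=
  K ^+ 2 * (3 / 2) ^+ m * (2 / 3) ^+ size w * (17 / 18) ^+ n.
Proof.
elim: n w => [|n IHn] w rw.
  rewrite expr0 mulr1.
  have bfw : bounded_mfun (f \o walk w).
    exact: bounded_mfun_comp (measurable_walk w) bf.
  have w0 : 0 <= K ^+ 2 * (3 / 2) ^+ m * (2 / 3) ^+ size w.
    apply: mulr_ge0; last by rewrite exprn_ge0//; lra.
    by apply: mulr_ge0; rewrite ?sqr_ge0// exprn_ge0//; lra.
  have [wm|mw] := leqP (size w) m; last by rewrite f_indep.
  apply: le_trans (inner_bound mu bfw bf (K := K) _ fK) _ => //=.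
  rewrite -mulrA ler_peMr ?sqr_ge0//.
  rewrite -(subnKC wm) exprD mulrAC -exprMn.
  rewrite (_ : 3 / 2 * (2 / 3) = 1 :> R); last by field.
  by rewrite expr1n mul1r exprn_ege1//; lra.
rewrite iterS -avg_adjoint; first last.
- exact: bounded_mfun_iter_avg.
- exact: bounded_mfun_comp (measurable_walk w) bf.
rewrite inner_avgl; first last.
- exact: bounded_mfun_iter_avg.
- exact: bounded_mfun_comp (measurable_walk w) bf.
set c := K ^+ 2 * (3 / 2) ^+ m.
apply: (@le_trans _ _ (3^-1 * \sum_(i < 3)
    (c * (2 / 3) ^+ size (push i w) * (17 / 18) ^+ n))).
  rewrite ler_wpM2l ?invr_ge0//; apply: ler_sum => i _.
  apply: le_trans (IHn _ (reduced_push i rw)).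
  rewrite (_ : f \o walk (push i w) = (f \o walk w) \o T i)//.
  by apply/funext => x /=; rewrite walk_push.
have c0 : 0 <= c * (17 / 18) ^+ n.
  apply: mulr_ge0; last by rewrite exprn_ge0//; lra.
  by apply: mulr_ge0; rewrite ?sqr_ge0// exprn_ge0//; lra.
under eq_bigr do rewrite mulrAC.
rewrite -mulr_sumr exprS.
apply: (@le_trans _ _
  (3^-1 * (c * (17 / 18) ^+ n * (3 * (17 / 18) * (2 / 3) ^+ size w)))).
  by rewrite ler_wpM2l ?invr_ge0// ler_wpM2l// sum_weight_push.
by rewrite le_eqVlt; apply/orP; left; apply/eqP; field.
Qed.

Lemma avg_spectral_gap : inner mu f (avg f) <= 17 / 18 * inner mu f f.
Proof.
apply: (@spectral_ratio _ (fun n => inner mu f (iter n avg f)) _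
  (K ^+ 2 * (3 / 2) ^+ m)) => [||n|n]; first by lra.
- exact: inner_ge0.
- have bn := bounded_mfun_iter_avg n bf.
  apply: le_trans (inner_cauchy_schwarz mu bf bn) _ => /=.
  by rewrite iter_avg_adjoint// -iterD.
- by have := @walk_correlation_decay n [::] isT; rewrite expr0 mulr1.
Qed.

End Decay.

(** This is [avg_spectral_gap] for f = 1_B - P(B): then
    <f, f> = P(B) (1 - P(B)) and <f o T_i, f> = <f, f> - P(B \ T_i^-1 B), and
    the constant 6 is (1/3) / (1 - 17/18). *)
Lemma tree_expansion_finite_range (B : set X) (m : nat) : measurable B ->
    (forall w, reduced w -> (m < size w)%N ->
      prob mu (walk w @^-1` B `&` B) = prob mu B ^+ 2) ->
  prob mu B * (1 - prob mu B) <=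
  6 * \sum_(i < 3) prob mu (B `\` T i @^-1` B).
Proof.
move=> mB indep; set b := prob mu B.
pose f : X -> R := fun x => \1_B x - b.
have bf : bounded_mfun f.
  exact: bounded_mfunD (bounded_mfun_indic _ mB) (bounded_mfun_cst _ _).
have [K fK] := bf.2.
have mT i : measurable (T i @^-1` B).
  exact: preimage_measurable (T_preserving i).1 mB.
have PT i : prob mu (T i @^-1` B) = b by rewrite /prob (T_preserving i).2.
have Pw w : prob mu (walk w @^-1` B) = b.
  rewrite /b /prob; congr fine; elim: w => // i w <-.
  have mw := preimage_measurable (measurable_walk w) mB.
  by rewrite -((T_preserving i).2 _ mw).
have f_indep w : reduced w -> (m < size w)%N -> inner mu (f \o walk w) f = 0.
  move=> rw mw.
  have mw' := preimage_measurable (measurable_walk w) mB.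
  have -> : f \o walk w = (fun x => \1_(walk w @^-1` B) x - b) by [].
  by rewrite inner_indic// -!/(prob mu _) indep// Pw -/b; ring.
have := avg_spectral_gap bf fK f_indep.
rewrite innerC inner_avgl// inner_indic// setIid -!/(prob mu _) -/b.
under eq_bigr => i _.
  have -> : f \o T i = (fun x => \1_(T i @^-1` B) x - b) by [].
  rewrite inner_indic// -!/(prob mu _) PT -/b.
  have -> : prob mu (T i @^-1` B `&` B) = b - prob mu (B `\` T i @^-1` B).
    rewrite (probD mu mB (mT i)) setIC -/b; ring.
  over.
rewrite !big_ord_recl !big_ord0 /=; lra.
Qed.

End TreeWalk.

(** * The product measure: relabelling and independence *)

Section ProductMeasure.
Variables (R : realType) (G : groupType).
Variable mu : probability (seeds R G) R.
Hypothesis mu_product : lebesgue_product mu.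

Definition box (s : seq G) (B : G -> set R) : set (seeds R G) :=
  [set x | forall g, g \in s -> B g (val (x g))].

Definition boxes : set (set (seeds R G)) :=
  [set A | exists s B,
    [/\ uniq s, forall g, measurable (B g) & A = box s B]].

Definition slice (B : set R) : R := fine (lebesgue_measure (B `&` `[0%R, 1%R])).

Lemma lebesgue_slice (B : set R) : measurable B ->
  lebesgue_measure (B `&` `[0%R, 1%R]) = (slice B)%:E.
Proof.
move=> mB; rewrite fineK// ge0_fin_numE ?measure_ge0//.
apply: (@le_lt_trans _ _ (@lebesgue_measure R `[0%R, 1%R]%classic)).
  by apply: le_measure => //; rewrite inE//=; exact: measurableI.
by rewrite lebesgue_measure_itv/= lte01 oppr0 adde0 ltry.
Qed.

Lemma slice0 : slice set0 = 0.
Proof. by rewrite /slice set0I measure0. Qed.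

Lemma sliceT : slice setT = 1.
Proof. by rewrite /slice setTI lebesgue_measure_itv/= lte01 oppr0 adde0. Qed.

Lemma prob_box s B : uniq s -> (forall g, measurable (B g)) ->
  prob mu (box s B) = \prod_(g <- s) slice (B g).
Proof.
move=> us mB; rewrite /prob (mu_product us mB).
rewrite (eq_bigr (fun g => (slice (B g))%:E)) ?prodEFin// => g _.
by rewrite lebesgue_slice.
Qed.

Lemma measurable_coord g (B : set R) : measurable B ->
  measurable [set x : seeds R G | B (val (x g))].
Proof. by move=> mB; apply: sub_sigma_algebra; exists g, B. Qed.

Lemma measurable_box s B : (forall g, measurable (B g)) ->
  measurable (box s B).
Proof.
move=> mB; elim: s => [|g s IHs].
  by rewrite (_ : box _ _ = setT)//; apply/seteqP; split.
rewrite (_ : box _ _ = [set x : seeds R G | B g (val (x g))] `&` box s B).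
  by apply: measurableI => //; exact: measurable_coord.
apply/seteqP; split=> x /=.
  move=> bx; split=> [|h hs]; first by apply: bx; rewrite mem_head.
  by apply: bx; rewrite inE hs orbT.
by move=> [xg bx] h; rewrite inE => /orP[/eqP ->//|]; exact: bx.
Qed.

Lemma boxE_sub s t B : {subset s <= t} ->
  box s B = box t (fun g => if g \in s then B g else setT).
Proof.
move=> st; apply/seteqP; split=> x bx g.
  by case: ifP => // gs _; exact: bx.
by move=> gs; have := bx g (st g gs); rewrite gs.
Qed.

Lemma box_setI s B C : box s B `&` box s C = box s (fun g => B g `&` C g).
Proof.
apply/seteqP; split=> x.
  by move=> [bB bC] g gs; split; [exact: bB|exact: bC].
by move=> bx; split=> g gs; have [] := bx g gs.
Qed.

(** Two boxes can be written over the same finite set of coordinates, leaving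
    the additional coordinates unconstrained. *)
Lemma boxes_common A B : boxes A -> boxes B ->
  exists s C D, [/\ uniq s, forall g, measurable (C g),
    forall g, measurable (D g), A = box s C & B = box s D].
Proof.
move=> [s [C [us mC ->]]] [t [D [ut mD ->]]].
exists (undup (s ++ t)), (fun g => if g \in s then C g else setT),
  (fun g => if g \in t then D g else setT); split=> [|g|g||].
- exact: undup_uniq.
- by case: ifP.
- by case: ifP.
- by apply: boxE_sub => g gs; rewrite mem_undup mem_cat gs.
- by apply: boxE_sub => g gs; rewrite mem_undup mem_cat gs orbT.
Qed.

Lemma boxes_setI : setI_closed boxes.
Proof.
move=> A B bA bB; have [s [C [D [us mC mD -> ->]]]] := boxes_common bA bB.
rewrite box_setI; exists s, (fun g => C g `&` D g); split=> // g.
exact: measurableI.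
Qed.

Lemma boxesT : boxes setT.
Proof.
by exists [::], (fun=> setT); split=> //; apply/seteqP; split.
Qed.

Lemma measurable_boxes : boxes `<=` measurable.
Proof. by move=> _ [s [B [_ mB ->]]]; exact: measurable_box. Qed.

Lemma measurable_seedsE : @measurable _ (seeds R G) = <<s boxes >>.
Proof.
apply/seteqP; split=> A.
  apply: smallest_sub; first exact: smallest_sigma_algebra.
  move=> _ [g [B [mB ->]]]; apply: sub_sigma_algebra.
  exists [:: g], (fun=> B); split=> //; apply/seteqP; split=> x /=.
    by move=> xB h; rewrite inE => /eqP ->.
  by apply; rewrite mem_head.
apply: smallest_sub => //; last exact: measurable_boxes.
exact: sigma_algebra_measurable.
Qed.

(** Boxes form a generating pi-system of sets of known measure; this is what
    makes [lebesgue_product] determine the measure. *)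
Lemma seeds_measure_unique (m1 m2 : {measure set (seeds R G) -> \bar R}) :
    (m1 setT < +oo)%E -> (forall A, boxes A -> m1 A = m2 A) ->
  forall A, measurable A -> m1 A = m2 A.
Proof.
move=> m1T m12; apply: (measure_unique boxes (fun=> setT)) => //.
- exact: measurable_seedsE.
- exact: boxes_setI.
- by move=> _; exact: boxesT.
- exact: bigcup_const.
Qed.

Lemma seeds_measurable_fun (T : seeds R G -> seeds R G) :
    (forall g (B : set R), measurable B ->
      measurable [set x | B (val (T x g))]) ->
  measurable_fun setT T.
Proof.
move=> mT; apply: (@measurability _ _ (seeds R G) (seeds R G) setT T
  (@coord_cylinders R G)) => //.
by move=> _ [_ [g [B [mB ->]]] <-]; rewrite setTI; exact: mT.
Qed.

Definition relabel (h : G -> G) (x : seeds R G) : seeds R G := x \o h.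

Lemma relabel_preserving (h k : G -> G) : cancel h k -> cancel k h ->
  measure_preserving mu (relabel h).
Proof.
move=> hk kh.
have mh : measurable_fun setT (relabel h).
  by apply: seeds_measurable_fun => g B; exact: measurable_coord.
split=> // A mA.
apply: (@seeds_measure_unique (pushforward mu (relabel h)) mu) => // [|B].
  by rewrite [X in (X < _)%E](_ : _ = mu setT)// probability_setT ltry.
move=> [s [C [us mC ->]]].
transitivity (mu (box (map h s) (C \o k))).
  congr (mu _); apply/seteqP; split=> x bx g.
    by move=> /mapP[f fs ->]; rewrite /= hk; exact: bx.
  by move=> gs; have := bx (h g) (map_f h gs); rewrite /= hk.
transitivity (prob mu (box s C))%:E; last first.
  by rewrite -probE//; exact: measurable_box.
rewrite probE; last by apply: measurable_box => g; exact: mC.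
have us' : uniq (map h s) by rewrite map_inj_uniq//; exact: can_inj hk.
congr (_%:E); rewrite !prob_box//; last by move=> g; exact: mC.
by rewrite big_map; apply: eq_bigr => g _ /=; rewrite hk.
Qed.


(** Replacing the seeds outside s by a default value is a measurable map, and an
    event that depends on s is its own preimage under it.  Independence can
    thus be stated for preimages under [restrict] of arbitrary events. *)
Definition restrict (s : seq G) (x : seeds R G) : seeds R G :=
  fun g => if g \in s then x g else point.

Definition depends_on (s : seq G) (A : set (seeds R G)) :=
  forall x y, (forall g, g \in s -> x g = y g) -> A x -> A y.

Lemma restrict_measurable s : measurable_fun setT (restrict s).
Proof.
apply: seeds_measurable_fun => g B mB; rewrite /restrict.
case: (g \in s); first exact: measurable_coord.
have [Bp|nBp] := pselect (B (val (point : unit_itv R))).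
  by rewrite (_ : [set x | _] = setT)//; apply/seteqP; split.
by rewrite (_ : [set x | _] = set0)//; apply/seteqP; split.
Qed.

Lemma depends_on_restrict s A : depends_on s A -> restrict s @^-1` A = A.
Proof.
by move=> dA; apply/seteqP; split=> x; apply: dA => g gs; rewrite /restrict gs.
Qed.

(** The sides of the box [restrict s @^-1` box t B]: outside s the seed has
    been replaced by the default point, so that a side is everything or
    nothing. *)
Definition pad (s : seq G) (B : G -> set R) (g : G) : set R :=
  if g \in s then B g else [set _ | B g (val (point : unit_itv R))].

Lemma pad_off s B g : g \notin s -> pad s B g = setT \/ pad s B g = set0.
Proof.
move=> /negPf gs; rewrite /pad gs.
have [Bp|nBp] := pselect (B g (val (point : unit_itv R))).
  by left; apply/seteqP; split.
by right; apply/seteqP; split.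
Qed.

Lemma measurable_pad s B g :
  (forall g, measurable (B g)) -> measurable (pad s B g).
Proof.
move=> mB; have [gs|/(@pad_off _ B)[->|->]//] := boolP (g \in s).
by rewrite /pad gs; exact: mB.
Qed.

Lemma restrict_box s t B : restrict s @^-1` box t B = box t (pad s B).
Proof.
by apply/seteqP; split=> x bx g /bx; rewrite /restrict /pad; case: (g \in s).
Qed.

(** At every coordinate one of the two sides has measure 0 or 1, which makes
    the measure multiplicative on their intersection. *)
Lemma slice_pad_setI s t B C g : ~~ ((g \in s) && (g \in t)) ->
  slice (pad s B g `&` pad t C g) = slice (pad s B g) * slice (pad t C g).
Proof.
rewrite negb_and => /orP[gs|gt].
  have [->|->] := pad_off B gs; first by rewrite setTI sliceT mul1r.
  by rewrite set0I slice0 mul0r.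
have [->|->] := pad_off C gt; first by rewrite setIT sliceT mulr1.
by rewrite setI0 slice0 mulr0.
Qed.

Lemma restrict_indep_boxes s t A B : (forall g, ~~ ((g \in s) && (g \in t))) ->
    boxes A -> boxes B ->
  prob mu (restrict s @^-1` A `&` restrict t @^-1` B) =
  prob mu (restrict s @^-1` A) * prob mu (restrict t @^-1` B).
Proof.
move=> st bA bB; have [u [C [D [uu mC mD -> ->]]]] := boxes_common bA bB.
rewrite !restrict_box box_setI !prob_box//; last first.
- by move=> g; apply: measurableI; exact: measurable_pad.
- by move=> g; exact: measurable_pad.
- by move=> g; exact: measurable_pad.
by rewrite -big_split; apply: eq_bigr => g _; exact: slice_pad_setI.
Qed.

(** For fixed D, both sides are finite measures in B, so it suffices to compare
    them on boxes.  Used once for each of the two events to pass from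
    independence of boxes to independence of measurable events. *)
Lemma indep_box_extend (D : set (seeds R G)) (T : seeds R G -> seeds R G) :
    measurable D -> measurable_fun setT T ->
    (forall B, boxes B -> prob mu (D `&` T @^-1` B) =
      prob mu D * prob mu (T @^-1` B)) ->
  forall B, measurable B -> prob mu (D `&` T @^-1` B) =
      prob mu D * prob mu (T @^-1` B).
Proof.
move=> mD mT DT B mB.
have mTB := preimage_measurable mT mB.
pose r := NngNum (prob_ge0 mu D).
have mres C : measurable C ->
    pushforward (mrestr mu mD) T C = (prob mu (D `&` T @^-1` C))%:E.
  move=> mC; have mTC := preimage_measurable mT mC.
  by rewrite -probE; [rewrite setIC|exact: measurableI].
have mscl C : measurable C ->
    mscale r (pushforward mu T) C = (prob mu D * prob mu (T @^-1` C))%:E.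
  move=> mC; have mTC := preimage_measurable mT mC.
  by rewrite EFinM -(probE mu mTC).
apply: EFin_inj; rewrite -mres// -(mscl mT)//.
apply: seeds_measure_unique => // [|C bC].
  apply: (@le_lt_trans _ _ (prob mu (D `&` T @^-1` setT))%:E); last exact: ltry.
  by rewrite -mres.
have mC := measurable_boxes bC.
transitivity (prob mu (D `&` T @^-1` C))%:E; first exact: mres.
by rewrite DT//; exact: esym (mscl mT C mC).
Qed.

Lemma restrict_indep s t A B : (forall g, ~~ ((g \in s) && (g \in t))) ->
    measurable A -> measurable B ->
  prob mu (restrict s @^-1` A `&` restrict t @^-1` B) =
  prob mu (restrict s @^-1` A) * prob mu (restrict t @^-1` B).
Proof.
move=> st mA mB.
have mr u C : measurable C -> measurable (restrict u @^-1` C).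
  exact: preimage_measurable (restrict_measurable u).
apply: (indep_box_extend (T := restrict t)) => //; first exact: mr.
  exact: restrict_measurable.
move=> {mB}B bB; rewrite setIC mulrC.
apply: (indep_box_extend (T := restrict s)) => //.
- exact: mr (measurable_boxes bB).
- exact: restrict_measurable.
by move=> {mA}A bA; rewrite setIC mulrC restrict_indep_boxes.
Qed.

Lemma depends_on_indep s t A B : (forall g, ~~ ((g \in s) && (g \in t))) ->
    measurable A -> measurable B -> depends_on s A -> depends_on t B ->
  prob mu (A `&` B) = prob mu A * prob mu B.
Proof.
move=> st mA mB dA dB.
by rewrite -(depends_on_restrict dA) -(depends_on_restrict dB) restrict_indep.
Qed.

End ProductMeasure.

(** * Expansion of the Bernoulli action of C_2 * C_2 * C_2 *)

Section Approximation.
Variables (R : realType) (G : groupType).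
Variable mu : probability (seeds R G) R.

Definition finite_range_approx (A : set (seeds R G)) := forall e : R, 0 < e ->
  exists s B, [/\ measurable B, depends_on s B,
    prob mu (A `\` B) <= e & prob mu (B `\` A) <= e].

Lemma finite_range_approx_self s (A : set (seeds R G)) :
  measurable A -> depends_on s A -> finite_range_approx A.
Proof.
move=> mA dA e e0; exists s, A; rewrite setDv.
have -> : prob mu set0 = 0 by rewrite /prob measure0.
by split=> //; exact: ltW.
Qed.

Lemma finite_range_approxC A :
  finite_range_approx A -> finite_range_approx (~` A).
Proof.
move=> aA e /aA[s [B [mB dB AB BA]]]; exists s, (~` B); split.
- exact: measurableC.
- by move=> x y xy nBx By; apply: nBx; apply: dB By => g gs; rewrite xy.
- by rewrite setDE setCK setIC -setDE.
- by rewrite setDE setCK setIC -setDE.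
Qed.

Lemma finite_range_approxU A A' : measurable A -> measurable A' ->
  finite_range_approx A -> finite_range_approx A' ->
  finite_range_approx (A `|` A').
Proof.
move=> mA mA' aA aA' e e0; have e2 : 0 < e / 2 by rewrite divr_gt0.
have [s [B [mB dB AB BA]]] := aA _ e2.
have [t [C [mC dC AC CA]]] := aA' _ e2.
have half (D E F : set (seeds R G)) : measurable D -> measurable E ->
    measurable F -> D `<=` E `|` F ->
    prob mu E <= e / 2 -> prob mu F <= e / 2 -> prob mu D <= e.
  move=> mD mE mF DEF E2 F2; apply: le_trans (le_prob mu mD _ DEF) _.
    exact: measurableU.
  apply: le_trans (prob_setU mu mE mF) _.
  by rewrite [e]splitr; exact: lerD.
exists (s ++ t), (B `|` C); split.
- exact: measurableU.
- move=> x y xy [Bx|Cx]; [left; apply: dB Bx|right; apply: dC Cx] => g gs;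
    by apply: xy; rewrite mem_cat gs ?orbT.
- apply: half AB AC; try exact: measurableD.
    by apply: measurableD => //; exact: measurableU.
  move=> x [AA nBC]; case: AA => Ax; [left|right]; split=> // Bx; apply: nBC;
    by [left|right].
- apply: half BA CA; try exact: measurableD.
    by apply: measurableD => //; exact: measurableU.
  move=> x [AA nBC]; case: AA => Ax; [left|right]; split=> // Bx; apply: nBC;
    by [left|right].
Qed.

Lemma prob_bigcup_tail (A : (set (seeds R G))^nat) (e : R) :
    (forall n, measurable (A n)) -> 0 < e ->
  exists N, prob mu ((\bigcup_n A n) `\` \big[setU/set0]_(i < N) A i) <= e.
Proof.
move=> mA e0; pose F n := \big[setU/set0]_(i < n.+1) A i.
have mF n : measurable (F n) by exact: bigsetU_measurable.
have UF : \bigcup_n F n = \bigcup_n A n by exact: bigcup_bigsetU_bigcup.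
have mU : measurable (\bigcup_n A n) by exact: bigcupT_measurable.
have cvF : mu (F n) @[n --> \oo] --> mu (\bigcup_n F n).
  apply: nondecreasing_cvg_mu => //; first by rewrite UF.
  by move=> m n mn; apply/subsetPset; exact: subset_bigsetU.
rewrite UF probE// in cvF.
have /fine_cvgP[_ cvP] := cvF.
have lt : prob mu (\bigcup_n A n) - e < prob mu (\bigcup_n A n).
  by rewrite ltrBlDr ltrDl.
have [N _ /(_ N (leqnn N)) /= PN] := cvgr_gt _ cvP _ lt.
exists N.+1; rewrite probD//; last exact: mF.
rewrite setIidr; last by rewrite -UF; exact: bigcup_sup.
by move: PN; rewrite -/(prob mu (F N)) -/(F N) => PN; lra.
Qed.

Lemma finite_range_approx_bigcup (F : (set (seeds R G))^nat) :
    (forall n, measurable (F n)) -> (forall n, finite_range_approx (F n)) ->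
  finite_range_approx (\bigcup_n F n).
Proof.
move=> mF aF e e0; have e2 : 0 < e / 2 by rewrite divr_gt0.
have mU : measurable (\bigcup_n F n) by exact: bigcupT_measurable.
have [N UN] := prob_bigcup_tail mF e2.
set V := \big[setU/set0]_(i < N) F i in UN.
have [mV aV] : measurable V /\ finite_range_approx V.
  rewrite /V; elim/big_ind: _ => [|B C [mB aB] [mC aC]|i _] //.
    by split=> //; apply: (finite_range_approx_self (s := [::])).
  by split; [exact: measurableU|exact: finite_range_approxU].
have [s [B [mB dB VB BV]]] := aV _ e2.
exists s, B; split=> //.
  have sub : (\bigcup_n F n) `\` B `<=` ((\bigcup_n F n) `\` V) `|` (V `\` B).
    by move=> x [Ux nBx]; have [Vx|nVx] := pselect (V x); [right|left].
  apply: le_trans (le_prob mu _ _ sub) _; try exact: measurableD.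
    by apply: measurableU; exact: measurableD.
  apply: le_trans (prob_setU mu _ _) _; try exact: measurableD.
  by rewrite [e]splitr; exact: lerD.
apply: (@le_trans _ _ (e / 2)); last by lra.
apply: le_trans BV; apply: le_prob; try exact: measurableD.
move=> x [Bx nUx]; split=> // Vx; apply: nUx.
by move: Vx; rewrite /V -bigcup_mkord => -[i _ Fx]; exists i.
Qed.

(** The approximable measurable events form a sigma-algebra that contains the
    coordinate cylinders. *)
Lemma measurable_finite_range_approx A : measurable A -> finite_range_approx A.
Proof.
pose Q (A : set (seeds R G)) := measurable A /\ finite_range_approx A.
suff QT : measurable `<=` Q by move=> /QT[].
apply: smallest_sub.
  split.
  - by split=> //; apply: (finite_range_approx_self (s := [::])).
  - move=> B [mB aB]; rewrite setTD.
    by split; [exact: measurableC|exact: finite_range_approxC].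
  move=> F QF; have mF n := (QF n).1; have aF n := (QF n).2.
  by split; [exact: bigcupT_measurable|exact: finite_range_approx_bigcup].
move=> _ [g [B [mB ->]]]; have mgB := measurable_coord (R := R) g mB.
split=> //; apply: (finite_range_approx_self (s := [:: g])) => // x y xy /=.
by rewrite xy ?mem_head.
Qed.

End Approximation.

Section BernoulliExpansion.
Variables (R : realType) (mu : probability (seeds R Gam) R).
Hypothesis mu_product : lebesgue_product mu.

Definition gen_shift (i : 'I_3) : seeds R Gam -> seeds R Gam :=
  relabel (fun h => (h * gen_a i)%g).

Definition word_elt (w : seq 'I_3) : Gam := \prod_(i <- w) gen_a i.

Lemma gen_aK i : (gen_a i * gen_a i = 1)%g.
Proof. by rewrite -expg2 gen_a2. Qed.

Lemma gen_aV i : ((gen_a i)^-1 = gen_a i)%g.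
Proof. by apply: (mulgI (gen_a i)); rewrite mulgV gen_aK. Qed.

Lemma gen_shiftK i : involutive (gen_shift i).
Proof.
move=> x; apply/funext => h; rewrite /gen_shift /relabel /=.
by rewrite -mulgA gen_aK mulg1.
Qed.

Lemma gen_shift_preserving i : measure_preserving mu (gen_shift i).
Proof.
have ai : cancel (fun h : Gam => (h * gen_a i)%g) (fun h => (h * gen_a i)%g).
  by move=> h; rewrite -mulgA gen_aK mulg1.
exact: (relabel_preserving mu_product ai ai).
Qed.

Lemma word_elt_len w : reduced w -> val (word_elt w).1 = w.
Proof.
rewrite /word_elt; elim: w => [|i w IHw] rw; first by rewrite big_nil.
rewrite big_cons /= IHw; last exact: path_sorted rw.
by case: w rw {IHw} => //= j w /andP[/negPf->].
Qed.

Lemma walk_gen_shiftE w x :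
  walk gen_shift w x = relabel (fun h => (h * (word_elt w)^-1)%g) x.
Proof.
rewrite /word_elt; elim: w x => [|i w IHw] x /=.
  by rewrite big_nil; apply/funext => h; rewrite /relabel /= invg1 mulg1.
rewrite IHw big_cons; apply/funext => h; rewrite /gen_shift /relabel /=.
by rewrite invgM gen_aV mulgA.
Qed.

(** If B depends on the finite set s, its translate by w depends on the
    translate of s by the inverse of w, which is disjoint from s as soon as w
    is longer than every h^-1 k with h, k in s. *)
Lemma far_walk_indep s (B : set (seeds R Gam)) :
    measurable B -> depends_on s B ->
  exists m, forall w, reduced w -> (m < size w)%N ->
    prob mu (walk gen_shift w @^-1` B `&` B) = prob mu B ^+ 2.
Proof.
move=> mB dB.
exists (\max_(h <- s) \max_(k <- s) size (val (h^-1 * k)%g.1)) => w rw mw.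
have pw : measure_preserving mu (walk gen_shift w).
  rewrite (_ : walk gen_shift w = relabel (fun h => (h * (word_elt w)^-1)%g)).
    apply: (relabel_preserving mu_product
      (k := fun h => (h * word_elt w)%g)) => h; by rewrite ?mulgVK ?mulgK.
  by apply/funext => x; rewrite walk_gen_shiftE.
rewrite (depends_on_indep mu_product
  (s := [seq (h * (word_elt w)^-1)%g | h <- s]) (t := s)) //.
- by rewrite expr2 {1}/prob pw.2.
- move=> g; apply/negP => /andP[/mapP[k ks ->] hs].
  move: mw; rewrite ltnNge => /negP; apply.
  set h := (k * _)%g in hs.
  apply: leq_trans (leq_bigmax_seq _ hs isT).
  apply: leq_trans (leq_bigmax_seq _ ks isT).
  by rewrite /h invgM invgK -mulgA mulVg mulg1 word_elt_len.
- exact: preimage_measurable pw.1 mB.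
- move=> x y xy; rewrite /= !walk_gen_shiftE; apply: dB => g gs.
  by rewrite /relabel /=; apply: xy; apply: map_f.
Qed.

(** Both sides of [tree_expansion_finite_range] are continuous in the event: if
    A \ B and B \ A have probability at most d, the left-hand sides for A and
    B differ by at most d and the right-hand ones by at most 6 * 3 * 2 d, so
    that d = e / 37 leaves an error of at most e. *)
Lemma bernoulli_expansion (A : set (seeds R Gam)) : measurable A ->
  prob mu A * (1 - prob mu A) <=
  6 * \sum_(i < 3) prob mu (A `\` gen_shift i @^-1` A).
Proof.
move=> mA; apply/ler_addgt0Pr => e e0.
have d0 : 0 < e / 37 by rewrite divr_gt0.
have [s [B [mB dB AB BA]]] := measurable_finite_range_approx mu mA d0.
have [m mP] := far_walk_indep mB dB.
have := tree_expansion_finite_range gen_shift_preserving gen_shiftK mB mP.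
have mT i D : measurable D -> measurable (gen_shift i @^-1` D).
  exact: preimage_measurable (gen_shift_preserving i).1.
have step i : prob mu (B `\` gen_shift i @^-1` B) <=
    prob mu (A `\` gen_shift i @^-1` A) + 2 * (e / 37).
  have sub : B `\` gen_shift i @^-1` B `<=` (B `\` A) `|`
      ((A `\` gen_shift i @^-1` A) `|` gen_shift i @^-1` (A `\` B)).
    move=> x [Bx nBx]; have [Ax|nAx] := pselect (A x); last by left.
    by right; have [Tx|nTx] := pselect ((gen_shift i @^-1` A) x); [right|left].
  have mAA : measurable (A `\` gen_shift i @^-1` A).
    by apply: measurableD => //; exact: mT.
  have mAB : measurable (gen_shift i @^-1` (A `\` B)).
    by apply: mT; exact: measurableD.
  have mU := measurableU _ _ mAA mAB.
  have mBA : measurable (B `\` A) by exact: measurableD.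
  have mBT : measurable (B `\` gen_shift i @^-1` B).
    by apply: measurableD => //; exact: mT.
  have := le_prob mu mBT (measurableU _ _ mBA mU) sub.
  have := prob_setU mu mBA mU; have := prob_setU mu mAA mAB.
  have -> : prob mu (gen_shift i @^-1` (A `\` B)) = prob mu (A `\` B).
    by rewrite /prob (gen_shift_preserving i).2//; exact: measurableD.
  lra.
have a0 := prob_ge0 mu A; have b0 := prob_ge0 mu B.
have a1 : prob mu A <= 1 by rewrite -subr_ge0 -probC//; exact: prob_ge0.
have b1 : prob mu B <= 1 by rewrite -subr_ge0 -probC//; exact: prob_ge0.
have ab : prob mu A - prob mu B <= e / 37.
  apply: le_trans AB; rewrite probD// lerD2l lerN2.
  by apply: le_prob => //; exact: measurableI.
have ba : prob mu B - prob mu A <= e / 37.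
  apply: le_trans BA; rewrite probD// lerD2l lerN2.
  by apply: le_prob => //; exact: measurableI.
rewrite !big_ord_recl !big_ord0.
have := step ord0; have := step (lift ord0 ord0).
have := step (lift ord0 (lift ord0 ord0)).
move: (prob mu A) (prob mu B) a0 a1 b0 b1 ab ba => a b a0 a1 b0 b1 ab ba.
have : a * (1 - a) - b * (1 - b) <= e / 37.
  have -> : a * (1 - a) - b * (1 - b) = (a - b) * (1 - a - b) by ring.
  nra.
lra.
Qed.

End BernoulliExpansion.

(** * Finite balls and the label patterns of triangles and squares *)

Section BallEvent.
Variables (G : groupType) (E : seq G).

Lemma finite_conn_set : finite_set [set g | conn_set E g].
Proof.
apply: (@sub_finite_set _ _ [set` E ++ map (fun g => g^-1)%g E]).
  move=> g /= /orP[gE|gE]; rewrite mem_cat ?gE// -[g]invgK.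
  by rewrite (map_f (fun h => h^-1)%g) ?orbT.
by apply/finite_seqP; eexists.
Qed.

Lemma finite_gball r : finite_set (gball E r).
Proof.
elim: r => [|r IHr].
  apply: (@sub_finite_set _ _ [set 1%g]); last exact: finite_set1.
  by move=> x [p [_ <- ]]; rewrite leqn0 => /nilP ->.
apply: (@sub_finite_set _ _ (gball E r `|`
   (fun p => (p.1 * p.2)%g) @` ([set g | conn_set E g] `*` gball E r))).
  move=> x [p [+ <-]]; case/lastP: p => [|p y]; first by left; exists [::].
  rewrite rcons_path last_rcons size_rcons ltnS => /andP[pp ay] pr.
  right; exists ((y * (last 1%g p)^-1)%g, last 1%g p) => /=; last exact: mulgVK.
  by split=> //; exists p.
rewrite finite_setU; split=> //; apply/finite_image/finite_setX => //.
exact: finite_conn_set.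
Qed.

Lemma finite_label : finite_set [set: label E].
Proof.
rewrite (_ : [set: label E] = val @^-1` [set g | conn_set E g]).
  apply: finite_preimage => [x y _ _|]; first exact: val_inj.
  exact: finite_conn_set.
by apply/seteqP; split=> // -[g gE].
Qed.

Lemma finite_ball_edges r :
  finite_set [set p : edge E | gball E r (val p).1 /\ gball E r (val p).2].
Proof.
rewrite (_ : mkset _ = val @^-1` (gball E r `*` gball E r)).
  apply: finite_preimage => [x y _ _|]; first exact: val_inj.
  by apply: finite_setX; exact: finite_gball.
by [].
Qed.

Lemma rooted_ball_iso_local r (c c' c0 : labelling E) :
    (forall p : edge E,
      gball E r (val p).1 -> gball E r (val p).2 -> c p = c' p) ->
  rooted_ball_iso r c c0 -> rooted_ball_iso r c' c0.
Proof.
move=> cc [phi [bphi phi1 aphi lphi]]; exists phi; split=> // p q p1 p2 pq.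
by rewrite -cc//; exact: lphi.
Qed.

(** Split according to the finitely many values of the label of the first
    edge of L, and recurse with this label fixed. *)
Lemma measurable_local_event d (X : measurableType d) (F : X -> labelling E)
    (L : seq (edge E)) (C : set (labelling E)) :
    (forall p s, measurable [set x | F x p = s]) ->
    (forall c c', {in L, c =1 c'} -> C c -> C c') ->
  measurable (F @^-1` C).
Proof.
move=> mF; elim: L C => [|p L IHL] C LC.
  have [[c Cc]|nC] := pselect (exists c, C c).
    rewrite (_ : _ @^-1` _ = setT)//; apply/seteqP; split=> // x _.
    exact: LC Cc.
  rewrite (_ : _ @^-1` _ = set0)//; apply/seteqP; split=> // x Cx.
  by case: nC; exists (F x).
pose upd (s : label E) (c : labelling E) : labelling E :=
  fun q => if q == p then s else c q.
have -> : F @^-1` C = \bigcup_(s in [set: label E])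
    ([set x | F x p = s] `&` F @^-1` [set c | C (upd s c)]).
  apply/seteqP; split=> x.
    move=> Cx; exists (F x p) => //; split=> //=; apply: LC Cx => q _.
    by rewrite /upd; case: eqP => [->|].
  move=> [s _ [xs Cx]]; apply: LC Cx => q _ /=.
  by rewrite /upd; case: eqP => [->|].
apply: fin_bigcup_measurable => [|s _]; first exact: finite_label.
apply: measurableI; first exact: mF.
apply: (IHL [set c | C (upd s c)]) => c c' cc' /=; apply: LC => q.
rewrite inE /upd; case: eqP => //= _ qL; exact: cc'.
Qed.

Lemma measurable_ball_event (R : realType) (F : seeds R G -> labelling E) r c0 :
  measurable_labelling F -> measurable [set x | rooted_ball_iso r (F x) c0].
Proof.
move=> mF; have [L LE] := (finite_seqP _).1 (finite_ball_edges r).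
apply: (@measurable_local_event _ _ F L [set c | rooted_ball_iso r c c0]).
  move=> p s; apply: (mF [set c | c p = s]).
  by apply: sub_sigma_algebra; exists p, s.
move=> c c' cc'; apply: rooted_ball_iso_local => p p1 p2; apply: cc'.
have : [set` L] p by rewrite -LE.
by [].
Qed.

End BallEvent.

Section Geometry.
Local Open Scope group_scope.

Notation a := gen_a.
Notation b := gen_b.

Definition sym_gens : seq Gam := [:: a 0%R; a 1%R; a 2%R; b; b^-1].

Lemma conn_set_gens g : conn_set gens g -> g \in sym_gens.
Proof.
have sg : all (fun h => h^-1 \in sym_gens) gens by vm_compute.
move=> /orP[gg|/(allP sg)]; last by rewrite invgK.
by rewrite -[sym_gens]/(gens ++ [:: b^-1]) mem_cat gg.
Qed.

(** The only triangle through the identity is the coset of b: a finite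
    computation over pairs of generators. *)
Lemma triangle_labels g h : g \in sym_gens -> h \in sym_gens ->
    conn_set gens (h * g^-1) ->
  (g = b /\ h = b^-1) \/ (g = b^-1 /\ h = b).
Proof.
have chk : all (fun g => all (fun h => conn_set gens (h * g^-1) ==>
  ((g == b) && (h == b^-1) || (g == b^-1) && (h == b))) sym_gens) sym_gens.
  by vm_compute.
move=> gS hS; move/allP: chk => /(_ g gS)/allP/(_ h hS)/implyP gh.
by move=> /gh/orP[/andP[/eqP-> /eqP->]|/andP[/eqP-> /eqP->]]; [left|right].
Qed.

(** The fourth vertex of a square on the identity, an a_j and a power of b is
    the obvious one, so opposite sides carry the same generator; again a
    finite computation.  Excluding the identity discards the degenerate
    square that goes back along a_j. *)
Lemma square_labels g t s :
    g \in [:: b; b^-1] -> t \in [:: a 0%R; a 1%R; a 2%R] ->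
    s \in sym_gens -> conn_set gens (s * t * g^-1) -> s * t != 1 -> s = g.
Proof.
have chk : all (fun g => all (fun t => all (fun s =>
    conn_set gens (s * t * g^-1) ==> (s * t != 1) ==> (s == g)) sym_gens)
    [:: a 0%R; a 1%R; a 2%R]) [:: b; b^-1].
  by vm_compute.
move=> gB tA sS; move/allP: chk => /(_ g gB)/allP/(_ t tA)/allP/(_ s sS).
by move=> /implyP st /st/implyP st' /st'/eqP.
Qed.
End Geometry.

(** * The orientation of triangles *)

Section IsoLabels.
Local Open Scope group_scope.

Notation a := gen_a.
Notation b := gen_b.

Lemma adj_sym (G : groupType) (E : seq G) (x y : G) : adj E x y = adj E y x.
Proof.
by rewrite /adj; apply/idP/idP => /conn_setV; rewrite invgM invgK.
Qed.

Lemma adj_mul (G : groupType) (E : seq G) (s x : G) :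
  conn_set E s -> adj E (s * x) x.
Proof. by move=> sE; rewrite adj_sym /adj mulgK. Qed.

Lemma conn_set_a i : conn_set gens (a i).
Proof. by case: i => [[|[|[|]]] ?]. Qed.

Lemma conn_set_b : conn_set gens b.
Proof. by []. Qed.

Lemma conn_set_bV : conn_set gens b^-1.
Proof. exact: conn_setV conn_set_b. Qed.

Lemma gball_step (G : groupType) (E : seq G) r (s x : G) :
  conn_set E s -> gball E r x -> gball E r.+1 (s * x).
Proof.
move=> sE [p [pp px pr]]; exists (rcons p (s * x)).
by rewrite rcons_path pp last_rcons size_rcons px adj_sym adj_mul.
Qed.

Lemma gball1 (G : groupType) (E : seq G) r : gball E r 1.
Proof. by exists [::]. Qed.

Definition edge_b : edge gens := exist _ (b * 1, 1) (adj_mul 1 conn_set_b).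
Definition edge_bV : edge gens := exist _ (b^-1 * 1, 1) (adj_mul 1 conn_set_bV).
Definition edge_ba i : edge gens :=
  exist _ (b * a i, a i) (adj_mul (a i) conn_set_b).

Lemma iso_label (G : groupType) (E : seq G) r (c : labelling E) (phi : G -> G)
    (p : edge E) :
    (forall x y,
      gball E r x -> gball E r y -> adj E (phi x) (phi y) = adj E x y) ->
    (forall p q : edge E, gball E r (val p).1 -> gball E r (val p).2 ->
      val q = (phi (val p).1, phi (val p).2) -> c p = std_diagram q) ->
    gball E r (val p).1 -> gball E r (val p).2 ->
  val (c p) = phi (val p).1 * (phi (val p).2)^-1.
Proof.
move=> aphi lphi p1 p2.
have adj_phi : adj E (phi (val p).1) (phi (val p).2).
  by rewrite aphi//; exact: valP p.
pose q : edge E := exist _ (phi (val p).1, phi (val p).2) adj_phi.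
by rewrite (lphi p q).
Qed.

(** A root-preserving isomorphism phi of the 2-ball maps the triangle
    {1, b, b^2} to itself, by [triangle_labels], hence permutes the a_i, and
    maps the square 1, b, b a_i, a_i to a square, where [square_labels]
    applies.  As c is the pullback of the standard labelling along phi, the
    labels are [phi b] on (b, 1), [phi b^-1] on (b^-1, 1), and [phi b] again
    on (b a_i, a_i). *)
Lemma ball_iso_labels (c : labelling gens) :
    rooted_ball_iso 2 c (@std_diagram _ gens) ->
  (forall i, c (edge_ba i) = c edge_b) /\
  (val (c edge_bV) = b <-> val (c edge_b) <> b).
Proof.
move=> [phi [[phiB phi_inj _] phi1 aphi lphi]].
have B1 : gball gens 1 1 by exact: gball1.
have ball2 s : conn_set gens s -> gball gens 2 s.
  by move=> sE; rewrite -[s]mulg1; exact: gball_step (gball1 _ _).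
have B2 : gball gens 2 1 by exact: gball1.
have Bb := ball2 _ conn_set_b.
have BbV := ball2 _ conn_set_bV.
have Ba i := ball2 _ (conn_set_a i).
have Bba i : gball gens 2 (b * a i).
  apply: gball_step => //; rewrite -[a i]mulg1.
  by apply: gball_step (gball1 _ _); exact: conn_set_a.
have inj x y : gball gens 2 x -> gball gens 2 y -> phi x = phi y -> x = y.
  by move=> Bx By; apply: phi_inj; rewrite inE.
have phi_gen s : conn_set gens s -> phi s \in sym_gens.
  move=> sE; apply: conn_set_gens; have := aphi 1 s B2 (ball2 _ sE).
  by rewrite /adj phi1 invg1 !mulg1 => ->.
have lab p := iso_label aphi lphi (p := p).
have lab_b : val (c edge_b) = phi b.
  by rewrite lab /= ?mulg1// phi1 invg1 mulg1.
have lab_bV : val (c edge_bV) = phi b^-1.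
  by rewrite lab /= ?mulg1// phi1 invg1 mulg1.
have lab_ba i : val (c (edge_ba i)) = phi (b * a i) * (phi (a i))^-1.
  by apply: lab; [exact: Bba|exact: Ba].
have tri : (phi b = b /\ phi b^-1 = b^-1) \/ (phi b = b^-1 /\ phi b^-1 = b).
  apply: triangle_labels; try exact: phi_gen.
  by have := aphi _ _ Bb BbV; rewrite {1}/adj => ->.
have bNbV : b <> b^-1 by [].
have baN j : b * a j <> 1 by case: j => [[|[|[|]]] ?].
split; last first.
  by rewrite lab_b lab_bV; case: tri => -[-> ->]; split=> // h; case: bNbV.
move=> i; apply: val_inj; rewrite lab_b lab_ba.
have phiaN x : conn_set gens x -> x <> a i -> phi (a i) <> phi x.
  by move=> xE xa /(inj _ _ (Ba i) (ball2 _ xE)) ax; apply: xa.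
apply: (@square_labels _ (phi (a i))).
- by rewrite !inE; case: tri => -[-> _]; rewrite eqxx ?orbT.
- have := phi_gen _ (conn_set_a i).
  have ab : phi (a i) <> phi b by exact: phiaN.
  have abV : phi (a i) <> phi b^-1.
    by apply: phiaN => //; exact: conn_set_bV.
  rewrite -[sym_gens]/([:: a 0%R; a 1%R; a 2%R] ++ [:: b; b^-1]) mem_cat.
  move=> /orP[//|]; rewrite !inE.
  by case: tri => -[pb pbV] /orP[/eqP ai|/eqP ai];
    [case: ab|case: abV|case: abV|case: ab]; rewrite ai ?pb ?pbV.
- apply: conn_set_gens.
  by have := aphi _ _ (Ba i) (Bba i); rewrite {1}/adj => ->; rewrite /adj mulgK.
- rewrite mulgVK; have := aphi _ _ Bb (Bba i); rewrite {1}/adj => ->.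
  rewrite /adj (_ : b * a i * b^-1 = a i); first exact: conn_set_a.
  have ab : commute (a i) b by exact/commgP/eqP/gen_ab.
  by rewrite -ab mulgK.
- rewrite mulgVK -phi1; apply/eqP => /(inj _ _ (Bba i) B2).
  exact: baN.
Qed.

End IsoLabels.

Section Automorphisms.
Local Open Scope group_scope.

Lemma mulr_adj (G : groupType) (E : seq G) (g x y : G) :
  adj E (x * g) (y * g) = adj E x y.
Proof. by rewrite /adj mulgKA. Qed.

Definition mulr_aut (G : groupType) (E : seq G) (g : G) : graph_aut E :=
  GraphAut (mulgVK g : cancel (fun x => x * g^-1) (fun x => x * g))
    (mulgK g) (mulr_adj E g^-1).

Definition flip (g : Gam) : Gam := (g.1, g.2^-1).

Lemma flipK : involutive flip.
Proof. by move=> [w k]; rewrite /flip /= invgK. Qed.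

Lemma I3_mulgC (x y : 'I_3) : x * y = y * x.
Proof. by apply: val_inj; rewrite /= addnC. Qed.

Lemma flipM : {morph flip : x y / x * y}.
Proof. by move=> [w k] [v l]; rewrite /flip /= invgM I3_mulgC. Qed.

Lemma flipV x : flip x^-1 = (flip x)^-1.
Proof. by []. Qed.

Lemma conn_set_flip x : conn_set gens (flip x) = conn_set gens x.
Proof.
have half y : conn_set gens y -> conn_set gens (flip y).
  have chk : all (fun h => conn_set gens (flip h)) sym_gens by vm_compute.
  by move=> /conn_set_gens/(allP chk).
by apply/idP/idP => /half//; rewrite flipK.
Qed.

Lemma flip_adj x y : adj gens (flip x) (flip y) = adj gens x y.
Proof. by rewrite /adj -flipV -flipM conn_set_flip. Qed.

Definition flip_aut : graph_aut gens := GraphAut flipK flipK flip_adj.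

End Automorphisms.

Section Main.
Variables (R : realType) (mu : probability (seeds R Gam) R).
Hypothesis mu_product : lebesgue_product mu.
Variable F : seeds R Gam -> labelling gens.
Hypothesis F_fiid : fiid_labelling mu F.

Let good := [set x | rooted_ball_iso 2 (F x) (@std_diagram Gam gens)].

Definition b_label : label gens := exist _ gen_b conn_set_b.
Let A := [set x | F x edge_b = b_label].

Lemma measurable_label_event p s : measurable [set x | F x p = s].
Proof.
apply: (F_fiid.1 [set c | c p = s]).
by apply: sub_sigma_algebra; exists p, s.
Qed.

Lemma equivariant_off_null (f : graph_aut gens) : exists N : set (seeds R Gam),
  [/\ measurable N, prob mu N = 0 &
   forall x, ~ N x -> F (act_seeds f x) = act_labelling f (F x)].
Proof.
have [N [mN N0 subN]] := F_fiid.2 f.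
exists N; split=> //; first by rewrite /prob N0.
by move=> x nNx; apply: contrapT => nF; apply/nNx/subN.
Qed.

(** By equivariance under right multiplication by a_i, the label of (b, 1) after
    the shift is the label of (b a_i, a_i), which is the same on a good ball. *)
Lemma orientation_invariant i :
  prob mu (A `\` gen_shift i @^-1` A) <= prob mu (~` good).
Proof.
have mA : measurable A by exact: measurable_label_event.
have mgood : measurable good by exact: measurable_ball_event F_fiid.1.
have mT : measurable (gen_shift (R := R) i @^-1` A).
  exact: preimage_measurable (gen_shift_preserving mu_product i).1 mA.
have mgC := measurableC mgood.
have [N [mN N0 FN]] := equivariant_off_null (mulr_aut gens (gen_a i)).
rewrite -[leRHS]addr0 -N0; apply: le_trans (prob_setU mu mgC mN).
apply: le_prob; [exact: measurableD|exact: measurableU|].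
move=> x [Ax nTx]; have [Nx|nNx] := pselect (N x); first by right.
left=> gx; apply: nTx; have [inv _] := ball_iso_labels gx.
rewrite /= /A /= -[gen_shift i x]/(act_seeds (mulr_aut gens (gen_a i)) x) FN//.
rewrite -[RHS]Ax -(inv i) /act_labelling /=.
congr (F x _); apply: val_inj => /=.
by rewrite mulg1 mul1g.
Qed.

(** By equivariance under the reflection, A pulls back to the event that
    (b^-1, 1) is labelled b, which on a good ball is the complement of A; and
    the reflection preserves the measure. *)
Lemma orientation_balanced : `|2 * prob mu A - 1| <= prob mu (~` good).
Proof.
have mA : measurable A by exact: measurable_label_event.
have mgood : measurable good by exact: measurable_ball_event F_fiid.1.
have mgC := measurableC mgood.
have [N [mN N0 FN]] := equivariant_off_null flip_aut.
have pf : measure_preserving mu (relabel flip).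
  exact: (relabel_preserving mu_product flipK flipK).
have mT : measurable (relabel flip @^-1` A).
  exact: preimage_measurable pf.1 mA.
have swap x : good x -> ~ N x -> (relabel flip @^-1` A) x <-> ~ A x.
  move=> gx nNx; have [_ flp] := ball_iso_labels gx.
  rewrite /A /= -[relabel flip x]/(act_seeds flip_aut x) FN//.
  have -> : act_labelling flip_aut (F x) edge_b = F x edge_bV.
    rewrite /act_labelling /=; congr (F x _); apply: val_inj.
    by apply/eqP; vm_compute.
  have lE s : s = b_label <-> val s = gen_b.
    by split=> [->//|sb]; exact: val_inj.
  by rewrite !lE.
have PT : prob mu (relabel flip @^-1` A) = prob mu A by rewrite /prob pf.2.
have mU1 := measurableU _ _ (measurableC mA) (measurableU _ _ mgC mN).
have mU2 := measurableU _ _ mT (measurableU _ _ mgC mN).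
have s1 : relabel flip @^-1` A `<=` ~` A `|` (~` good `|` N).
  move=> x Tx; have [gx|ngx] := pselect (good x); last by right; left.
  have [Nx|nNx] := pselect (N x); first by right; right.
  by left; apply: (swap x gx nNx).1.
have s2 : ~` A `<=` relabel flip @^-1` A `|` (~` good `|` N).
  move=> x Tx; have [gx|ngx] := pselect (good x); last by right; left.
  have [Nx|nNx] := pselect (N x); first by right; right.
  by left; apply: (swap x gx nNx).2.
have := le_prob mu mT mU1 s1; have := le_prob mu (measurableC mA) mU2 s2.
have mgN := measurableU _ _ mgC mN.
have := prob_setU mu mT mgN; have := prob_setU mu (measurableC mA) mgN.
have := prob_setU mu mgC mN; rewrite N0 PT (probC mu mA) => h1 h2 h3 h4 h5.
rewrite ler_norml; lra.
Qed.

(** If bad balls had probability less than 1/100, then P(A) (1 - P(A)) would be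
    close to 1/4 and yet at most 6 * 3 / 100. *)
Lemma good_ball_prob_le : prob mu good <= 99 / 100.
Proof.
have mA : measurable A by exact: measurable_label_event.
have mgood : measurable good by exact: measurable_ball_event F_fiid.1.
have := bernoulli_expansion mu_product mA.
have := orientation_balanced.
rewrite !big_ord_recl big_ord0 probC// ler_norml => /andP[lo hi].
have := orientation_invariant ord0.
have := orientation_invariant (lift ord0 ord0).
have := orientation_invariant (lift ord0 (lift ord0 ord0)).
rewrite probC// => i1 i2 i3 ex; rewrite leNgt; apply/negP => big.
nra.
Qed.

End Main.

Theorem corollary4p9 (R : realType) (mu : probability (seeds R Gam) R)
    (mu_product : lebesgue_product mu) :
  ~ exists F : nat -> seeds R Gam -> labelling gens,
      approx_fiid_cayley_diagram mu F.
Proof.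
move=> [F [F_fiid /(_ 2%N)/fine_cvgP[_ good_cvg]]].
have lt1 : 99 / 100 < 1 :> R by lra.
have [N _ /(_ N (leqnn N))] := cvgr_gt _ good_cvg _ lt1.
by rewrite ltNge (good_ball_prob_le mu_product (F_fiid N)).
Qed.
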